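(* Let $m\geq 3$. The algebra $T$ is isomorphic (as a $\mathbb{C}$-algebra) to \[ \bigoplus_{d=0}^{m}\Big(m-d-\big\lfloor\tfrac{m-d+1}{2}\big\rfloor+1\Big)\odot \mathbb{C}^{(d+1)\times(d+1)}, \] where $n\odot B$ denotes the direct sum of $n$ copies of the algebra $B$.
   Context: Let $m\geq 3$, $S=\{1,\ldots,2m+1\}$, $X$ the set of $m$-subsets of $S$, and $O_{m+1}$ the Odd graph on $X$ (adjacency = disjointness), with distance $\partial$ and diameter $m$. Let $x_0=\{1,\ldots,m\}$, $A_1$ the adjacency matrix, $E^*_i$ ($0\leq i\leq m$) the diagonal $X\times X$ matrix with $(y,y)$-entry $1$ iff $\partial(x_0,y)=i$, and $T$ the (Terwilliger) algebra of complex matrices generated by $A_1,E^*_0,\ldots,E^*_m$. *)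

(* Defs.v *)
From mathcomp Require Import all_boot all_order all_algebra.
From mathcomp Require Import reals complex.
Set Implicit Arguments. Unset Strict Implicit. Unset Printing Implicit Defensive.
Import Order.TTheory GRing.Theory Num.Theory.
Local Open Scope ring_scope.

(* S = {1,...,2m+1} is modelled (0-based) by 'I_(2m+1). *)
Definition Sset (m : nat) := 'I_(m.*2.+1).

Definition oadj (m : nat) (A B : {set Sset m}) : bool :=
  [&& #|A| == m, #|B| == m & [disjoint A & B]].

Fixpoint owalk (m : nat) (k : nat) (A B : {set Sset m}) : bool :=
  match k with
  | 0 => A == B
  | k'.+1 => [exists C : {set Sset m}, oadj A C && owalk k' C B]
  end.

(* graph distance: least k with a walk of length k (the graph is finite and
   connected, so a shortest walk has length < #|{set S}|). *)
Definition odist (m : nat) (A B : {set Sset m}) : nat :=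
  find (fun k => owalk k A B) (iota 0 #|{set Sset m}|).

Definition Xv (m : nat) := {A : {set Sset m} | #|A| == m}.

Definition x0 (m : nat) : {set Sset m} := [set i : Sset m | (i < m)%N].

Definition nX (m : nat) := #|{: Xv m}|.

Definition A1 (C : nzRingType) (m : nat) : 'M[C]_(nX m) :=
  \matrix_(i, j) (oadj (val (enum_val i : Xv m)) (val (enum_val j : Xv m)))%:R.

Definition Estar (C : nzRingType) (m : nat) (d : nat) : 'M[C]_(nX m) :=
  \matrix_(i, j) ((i == j) && (odist (x0 m) (val (enum_val i : Xv m)) == d))%:R.

Definition gen (C : nzRingType) (m : nat) (g : 'I_(m.+2)) : 'M[C]_(nX m) :=
  if (g : nat) is d.+1 then @Estar C m d else @A1 C m.

Definition word (C : nzRingType) (m : nat) (w : seq 'I_(m.+2)) : 'M[C]_(nX m) :=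
  foldr (fun g M => @gen C m g *m M) 1%:M w.

(* The Terwilliger algebra T: the (unital) algebra generated by the generators,
   i.e. the C-linear span of all finite products of generators. *)
Definition Talg (C : nzRingType) (m : nat) (M : 'M[C]_(nX m)) : Prop :=
  exists s : seq (C * seq 'I_(m.+2)), M = \sum_(p <- s) p.1 *: @word C m p.2.

Definition mult (m d : nat) : nat := (m - d - (m - d + 1)./2 + 1)%N.

Definition block (m : nat) :=
  {p : 'I_(m.+1) * 'I_(m.+1) | (p.2 < mult m p.1)%N}.

Definition bdim (m : nat) (b : block m) : nat := ((val b).1).+1.

Definition alg_iso_onto_sum (C : nzRingType) (n : nat) (B : finType)
    (dim : B -> nat) (T : 'M[C]_n -> Prop)
    (phi : forall b : B, 'M[C]_n -> 'M[C]_(dim b)) : Prop :=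
  [/\ (forall b a M N, T M -> T N -> phi b (a *: M + N) = a *: phi b M + phi b N),
      (forall b M N, T M -> T N -> phi b (M *m N) = phi b M *m phi b N),
      (forall b, phi b 1%:M = 1%:M),
      (forall M, T M -> (forall b, phi b M = 0) -> M = 0) &
      (forall N : forall b : B, 'M[C]_(dim b),
          exists2 M, T M & forall b, phi b M = N b)].

(* Main.v *)
Require Import Defs.
From mathcomp Require Import all_boot all_order all_algebra.
From mathcomp Require Import reals complex.
From mathcomp Require Import ring zify.
Set Implicit Arguments. Unset Strict Implicit. Unset Printing Implicit Defensive.
Import Order.TTheory GRing.Theory Num.Theory.
Local Open Scope ring_scope.

(** The distance of a vertex y to x0 and the level |y :&: x0| determine each
    other, so the dual idempotents are the projections onto the levels. For a list P
    of disjoint pairs, let h_P(y) be the product over P of [p.1 in y] - [p.2 in y].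
    If P has a pairs inside x0 and b pairs outside, then h_P(~: y) = (-1)^(a+b) h_P(y)
    and deleting one point of y inside (or outside) x0 in all ways multiplies h_P by
    a scalar. Hence the level components of h_P span a T-module on which A_1 acts by a
    matrix depending only on (a, b), supported on the levels from max(a, b-1) to
    m - max(a, b). The pairs (a, b) with nonempty support index the blocks.
    The representation on all the modules is faithful because the h_P span all
    functions on each level. It is onto because at the lowest level of a block the two
    closed walks of length two of A_1 have eigenvalues quadratic in a, resp. b, which
    separate the blocks, and A_1 moves between consecutive levels of a block with
    nonzero coefficients. *)

Lemma find_iota (p : pred nat) (n k : nat) : (k < n)%N -> p k ->
  (forall i, (i < k)%N -> ~~ p i) -> find p (iota 0 n) = k.
Proof.
move=> kn pk before.
have hasp : has p (iota 0 n) by apply/hasP; exists k; rewrite ?mem_iota.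
have fn : (find p (iota 0 n) < n)%N by rewrite -[X in (_ < X)%N](size_iota 0) -has_find.
apply/eqP; rewrite eqn_leq; apply/andP; split; rewrite leqNgt; apply/negP => lt.
  by have := before_find 0%N lt; rewrite nth_iota // pk.
by have := nth_find 0%N hasp; rewrite nth_iota // add0n (negPf (before _ lt)).
Qed.

(** * Distances in the odd graph *)

(* The distance from A to B in terms of j = #|A :&: B|. *)
Definition lev_dist (m j : nat) : nat := minn (m - j).*2 j.*2.+1.

Lemma lev_dist_le m j : (lev_dist m j <= m)%N.
Proof. rewrite /lev_dist; lia. Qed.

Lemma lev_dist_inj m j l : (j <= m)%N -> (l <= m)%N ->
  (lev_dist m j == lev_dist m l) = (j == l).
Proof. by move=> jm lm; apply/eqP/eqP => [|-> //]; rewrite /lev_dist; lia. Qed.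

Section OddGraph.
Variables (m : nat) (T : finType).
Hypothesis cardT : #|T| = m.*2.+1.
Implicit Types A B D : {set T}.

Definition disj_adj A B : bool := [&& #|A| == m, #|B| == m & [disjoint A & B]].

Fixpoint disj_walk (k : nat) A B : bool :=
  match k with
  | 0 => A == B
  | k'.+1 => [exists D : {set T}, disj_adj A D && disj_walk k' D B]
  end.

Lemma card_setC_odd A : (#|A| + #|~: A|)%N = m.*2.+1.
Proof. by rewrite cardsC. Qed.

(** Disjoint m-sets A and D cover all points but one, so B has m or m - 1 of its points in their
    union. *)
Lemma card_disj_adj_setI A B D : disj_adj A D -> #|B| = m ->
  (#|A :&: B| + #|D :&: B| <= m)%N /\ (m <= #|A :&: B| + #|D :&: B| + 1)%N.
Proof.
case/and3P => /eqP cA /eqP cD dAD cB.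
have dis : (A :&: B) :&: (D :&: B) = set0.
  apply/setP => x; rewrite !inE; case: (boolP (x \in A)) => //= xA.
  by rewrite (disjointFr dAD xA) andbF.
have c1 : #|(A :&: B) :|: (D :&: B)| = (#|A :&: B| + #|D :&: B|)%N.
  by rewrite cardsU dis cards0 subn0.
have c2 : #|A :|: D| = m.*2.
  by rewrite cardsU (disjoint_setI0 dAD) cards0 cA cD subn0 addnn.
have c3 := card_setC_odd (A :|: D); rewrite c2 in c3.
have c4 := cardsID (A :|: D) B; rewrite cB in c4.
have e4 : B :&: (A :|: D) = (A :&: B) :|: (D :&: B) by rewrite setIUr !(setIC B).
have c5 : (#|B :\: (A :|: D)| <= #|~: (A :|: D)|)%N.
  by apply/subset_leq_card/subsetP => x; rewrite !inE => /andP[].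
rewrite e4 c1 in c4; lia.
Qed.

(** One step turns the intersection number j with B into m - j or m - 1 - j, so two steps shift it
    by at most one. This yields the lower bound on distances. *)
Lemma disj_walk_card_setI k A B : #|A| = m -> #|B| = m -> disj_walk k A B ->
  if odd k then (#|A :&: B| <= k./2)%N else (m <= #|A :&: B| + k./2)%N.
Proof.
move=> cA cB; elim: k A cA => [|k IH] A cA /=.
  by move/eqP=> ->; rewrite setIid cB addn0.
case/existsP => D /andP[AD /IH].
have cD : #|D| = m by case/and3P: AD => _ /eqP.
move/(_ cD); have := card_disj_adj_setI AD cB; rewrite uphalf_half.
case: (odd k) => /=; lia.
Qed.

Lemma disj_adj_setCD1 A x : #|A| = m -> x \notin A -> disj_adj A (~: A :\ x).
Proof.
move=> cA xA; rewrite /disj_adj cA eqxx /=.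
have c1 := card_setC_odd A; rewrite cA in c1.
have c2 := cardsD1 x (~: A); rewrite inE xA in c2.
apply/andP; split; first by apply/eqP; lia.
by rewrite disjoint_sym disjoints_subset subD1set.
Qed.

(** Both parities go through one induction, since each first step changes the parity. An even walk
    first drops from the complement a point of B outside A and continues with the odd claim for r -
    1; an odd one drops a point outside A and B and continues with the even claim for r. *)
Lemma disj_walk_exists A B r : #|A| = m -> #|B| = m ->
  ((m = #|A :&: B| + r)%N -> disj_walk r.*2 A B) /\
  (#|A :&: B| = r -> disj_walk r.*2.+1 A B).
Proof.
move=> cA cB.
(* The set D, its neighbour and the point x partition the ground set, hence also the m points of
   B. *)
have step D x : #|D| = m -> x \notin D ->
    (#|D :&: B| + #|(~: D :\ x) :&: B| + (x \in B))%N = m.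
  move=> cD xD; have := cardsID D B; rewrite setIC cB.
  have := cardsD1 x (B :\: D); rewrite !inE xD /=.
  have -> : (B :\: D) :\ x = (~: D :\ x) :&: B by apply/setP => y; rewrite !inE andbA.
  lia.
elim: r A cA => [|r IH] A cA.
  split=> [E|E].
    rewrite /=; apply/eqP/setP/subset_cardP; first by rewrite cA cB.
    by apply/setIidPl/eqP; rewrite eqEcard subsetIl /= cA E addn0.
  have [x xAB] : exists x, x \in ~: (A :|: B).
    apply/set0Pn; rewrite -card_gt0; have := card_setC_odd (A :|: B).
    rewrite cardsU; lia.
  have xA : x \notin A by move: xAB; rewrite !inE => /norP[].
  have xB : x \notin B by move: xAB; rewrite !inE => /norP[].
  apply/existsP; exists (~: A :\ x); rewrite disj_adj_setCD1 //=.
  have /and3P[_ /eqP cD _] := disj_adj_setCD1 cA xA.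
  have := step _ _ cA xA; rewrite E (negPf xB) addn0 add0n => E2.
  apply/eqP/setP/subset_cardP; first by rewrite cD cB.
  by apply/setIidPl/eqP; rewrite eqEcard subsetIl /= cD E2.
have odd_step A' : #|A'| = m -> (m = #|A' :&: B| + r.+1)%N -> disj_walk r.+1.*2 A' B.
  move=> cA' E.
  have [x xAB] : exists x, x \in B :\: A'.
    apply/set0Pn; rewrite -card_gt0; have := cardsID A' B.
    rewrite setIC; lia.
  move: xAB; rewrite inE => /andP[xA xB].
  rewrite doubleS; apply/existsP; exists (~: A' :\ x); rewrite disj_adj_setCD1 //=.
  have /and3P[_ /eqP cD _] := disj_adj_setCD1 cA' xA.
  have := step _ _ cA' xA; rewrite xB => E2.
  by apply: (IH _ cD).2; lia.
split; first exact: odd_step.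
move=> E.
have [x xAB] : exists x, x \in ~: (A :|: B).
  apply/set0Pn; rewrite -card_gt0; have := card_setC_odd (A :|: B).
  rewrite cardsU; lia.
have xA : x \notin A by move: xAB; rewrite !inE => /norP[].
have xB : x \notin B by move: xAB; rewrite !inE => /norP[].
apply/existsP; exists (~: A :\ x); rewrite disj_adj_setCD1 //=.
have /and3P[_ /eqP cD _] := disj_adj_setCD1 cA xA.
have := step _ _ cA xA; rewrite (negPf xB) => E2.
by apply: odd_step => //; lia.
Qed.

Lemma find_disj_walk A B : #|A| = m -> #|B| = m ->
  find (fun k => disj_walk k A B) (iota 0 #|{set T}|) = lev_dist m #|A :&: B|.
Proof.
move=> cA cB; have le := subset_leq_card (subsetIl A B); rewrite cA in le.
apply: find_iota.
(* The search runs over 2^(2m+1) lengths, which exceeds the bound m on the distance. *)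
- apply: leq_ltn_trans (lev_dist_le m _) _.
  rewrite -cardsT -powersetT card_powerset cardsT cardT.
  by apply: leq_trans (ltn_expl m.*2.+1 (ltnSn 1)); lia.
- have [w1 w2] := disj_walk_exists (#|A :&: B|) cA cB.
  have [w3 _] := disj_walk_exists (m - #|A :&: B|) cA cB.
  rewrite /lev_dist /minn.
  case: ltnP => _; first by apply: w3; lia.
  exact: (w2 (erefl _)).
move=> i ilt; apply: contraTN ilt => /(disj_walk_card_setI cA cB).
rewrite -leqNgt /lev_dist; have := odd_double_half i.
by case: (odd i) => /=; lia.
Qed.

End OddGraph.

Lemma owalkE m k (A B : {set Sset m}) : owalk k A B = disj_walk m k A B.
Proof. by elim: k A => //= k IH A; apply: eq_existsb => D; rewrite IH. Qed.

Lemma odistE m (A B : {set Sset m}) :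
  #|A| = m -> #|B| = m -> odist A B = lev_dist m #|A :&: B|.
Proof.
move=> cA cB; rewrite -(find_disj_walk _ cA cB) ?card_ord //.
by apply: eq_find => k; rewrite owalkE.
Qed.

(** * Products of differences over disjoint pairs *)

Definition vert (T : Type) (P : seq (T * T)) : seq T :=
  flatten [seq [:: p.1; p.2] | p <- P].

Definition balanced (T : finType) (G : {set T}) (P : seq (T * T)) : bool :=
  all (fun p => (p.1 \in G) == (p.2 \in G)) P.

Definition npairs (T : finType) (G : {set T}) (P : seq (T * T)) : nat :=
  count (fun p => p.1 \in G) P.

(** For disjoint pairs these are the polytabloids of two-row Specht modules, written as polynomials
    in the indicators of points. *)
Definition pprod (C : nzRingType) (T : finType) (P : seq (T * T)) (A : {set T}) : C :=
  \prod_(p <- P) ((p.1 \in A)%:R - (p.2 \in A)%:R).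

Section PairProducts.
Variables (C : numFieldType) (T : finType).
Implicit Types (A B G : {set T}) (P : seq (T * T)).
Local Notation h := (@pprod C T).

Lemma pprod_nil A : h [::] A = 1.
Proof. exact: big_nil. Qed.

Lemma pprod_cons p P A : h (p :: P) A = ((p.1 \in A)%:R - (p.2 \in A)%:R) * h P A.
Proof. exact: big_cons. Qed.

Lemma pprod_cat P Q A : h (P ++ Q) A = h P A * h Q A.
Proof. exact: big_cat. Qed.

Lemma vert_cons p P : vert (p :: P) = p.1 :: p.2 :: vert P.
Proof. by []. Qed.

Lemma vert_cat P Q : vert (P ++ Q) = vert P ++ vert Q.
Proof. by rewrite /vert map_cat flatten_cat. Qed.

Lemma pprod_congr P A B : {in vert P, A =i B} -> h P A = h P B.
Proof.
elim: P => [|p P IH] AB; first by rewrite !pprod_nil.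
rewrite !pprod_cons !AB ?vert_cons ?inE ?eqxx ?orbT // IH // => x xP.
by rewrite AB // vert_cons !inE xP !orbT.
Qed.

Lemma pprod_setC P A : h P (~: A) = (-1) ^+ size P * h P A.
Proof.
elim: P => [|p P IH]; first by rewrite !pprod_nil expr0 mulr1.
rewrite !pprod_cons IH !inE /= exprS.
case: (p.1 \in A); case: (p.2 \in A) => /=; ring.
Qed.

Lemma pprod_setD1 P A x : x \notin vert P -> h P (A :\ x) = h P A.
Proof.
move=> xP; apply: pprod_congr => y yP; rewrite !inE.
by case: eqP yP xP => // -> ->.
Qed.

(** Deleting x changes the factor of a pair (p, q) by [x = p] - [x = q], and when this is nonzero
    the other factors stay as they are, all points being distinct. Summed over x, the correction is
    the factor itself if the pair lies in G, and 0 otherwise. *)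
Lemma pprod_down G P A : uniq (vert P) -> balanced G P ->
  \sum_(x in A :&: G) h P (A :\ x)
    = (#|A :&: G|%:R - (npairs G P)%:R) * h P A.
Proof.
elim: P => [|[p q] P IH].
  move=> _ _; under eq_bigr do rewrite pprod_nil.
  by rewrite sumr_const pprod_nil subr0 mulr1.
rewrite vert_cons /= inE negb_or => /andP[/andP[pq pP] /andP[qP uP]].
case/andP => /eqP /= pqG /(IH uP) {}IH.
rewrite pprod_cons /= /npairs /= natrD -/(npairs G P).
have -> : \sum_(x in A :&: G) h ((p, q) :: P) (A :\ x) =
  \sum_(x in A :&: G) ((p \in A)%:R - (q \in A)%:R) * h P (A :\ x)
  - \sum_(x in A :&: G) ((x == p)%:R - (x == q)%:R) * h P A.
  rewrite -sumrB; apply: eq_bigr => x; rewrite inE => /andP[xA xG].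
  rewrite pprod_cons /= !inE ![_ == x]eq_sym.
  have [xp | xp] := eqVneq x p.
    by rewrite -xp xA xp (negPf pq) /= (pprod_setD1 _ pP); ring.
  have [xq | xq] := eqVneq x q; last by rewrite /=; ring.
  by rewrite -xq xA xq (pprod_setD1 _ qP) /=; ring.
rewrite -mulr_sumr IH -mulr_suml sumrB.
have ind z : \sum_(x in A :&: G) (x == z)%:R = (z \in A :&: G)%:R :> C.
  rewrite big_mkcond (bigD1 z) //= big1 ?addr0.
    by rewrite eqxx; case: ifP.
  by move=> x /negPf ->; rewrite if_same.
rewrite !ind !inE -pqG.
case: (p \in G); rewrite ?andbT ?andbF /=; ring.
Qed.

(** Induction on the size of A in G: the left side of [pprod_down] vanishes term by term, while the
    scalar on its right is nonzero. *)
Lemma pprod_small G P A : uniq (vert P) -> balanced G P ->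
  (#|A :&: G| < npairs G P)%N -> h P A = 0.
Proof.
move=> uP bP; move Ek: #|A :&: G| => k.
elim: k => [|k IH] in A Ek *; move=> lt.
  have := pprod_down A uP bP; rewrite Ek big1 => [/esym/eqP|x].
    by rewrite mulf_eq0 subr_eq0 eqr_nat ltn_eqF // => /eqP.
  by rewrite (cards0_eq Ek) inE.
have := pprod_down A uP bP; rewrite Ek big1 => [/esym/eqP|x xA].
  by rewrite mulf_eq0 subr_eq0 eqr_nat ltn_eqF // => /eqP.
apply: IH; last exact: ltnW.
have -> : (A :\ x) :&: G = (A :&: G) :\ x by apply/setP => y; rewrite !inE andbA.
by have := cardsD1 x (A :&: G); rewrite Ek xA => -[].
Qed.

(** Where h_P(A) is nonzero, A contains exactly one point of every pair. *)
Lemma pprod_card_vert G P A : uniq (vert P) -> balanced G P ->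
  h P A * (count (fun x => x \in A :&: G) (vert P))%:R = h P A * (npairs G P)%:R.
Proof.
elim: P => [|[p q] P IH] //.
rewrite vert_cons /= inE negb_or => /andP[/andP[pq pP] /andP[qP uP]].
case/andP => /eqP /= pqG /(IH uP) {}IH.
rewrite /npairs /= !natrD pprod_cons /= -/(npairs G P).
rewrite !inE -pqG.
have E u v w : u * h P A * (v + (w + (count (fun x => x \in A :&: G) (vert P))%:R)) =
  u * (v + w) * h P A + u * (h P A * (npairs G P)%:R) by rewrite -IH; ring.
rewrite {}E.
case: (p \in G); rewrite ?andbT ?andbF; case: (p \in A); case: (q \in A) => /=; ring.
Qed.

(** The set A takes the first point of every pair and avoids the second one, whence the range of k
    from a to #|G| - a. *)
Lemma pairs_exist (a : nat) G : (a.*2 <= #|G|)%N ->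
  exists P, [/\ size P = a, uniq (vert P), {subset vert P <= G} &
    forall k, (a <= k)%N -> (k + a <= #|G|)%N ->
      exists A, [/\ A \subset G, #|A| = k & h P A = 1]].
Proof.
elim: a G => [|a IH] G.
  move=> _; exists [::]; split=> // k _; rewrite addn0 => kG.
  have /card_geqP [s [us sk sG]] := kG.
  exists [set x in s]; split; last exact: pprod_nil.
    by apply/subsetP => x; rewrite inE => /sG.
  by rewrite cardsE (card_uniqP us).
rewrite doubleS => aG.
have [x xG] : exists x, x \in G by apply/set0Pn; rewrite -card_gt0; lia.
have Gx := cardsD1 x G; rewrite xG in Gx.
have [y yG] : exists y, y \in G :\ x by apply/set0Pn; rewrite -card_gt0; lia.
have Gy := cardsD1 y (G :\ x); rewrite yG in Gy.
move: (yG); rewrite !inE => /andP[yx yG'].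
have [|P [sP uP PG hP]] := IH (G :\ x :\ y); first by lia.
have notP z : z \notin G :\ x :\ y -> z \notin vert P by apply: contra => /PG.
have xP : x \notin vert P by apply: notP; rewrite !inE eqxx /= andbF.
have yP : y \notin vert P by apply: notP; rewrite !inE eqxx.
exists ((x, y) :: P); split; first by rewrite /= sP.
- by rewrite vert_cons /= inE negb_or (eq_sym x) yx xP yP uP.
- move=> z; rewrite vert_cons !inE => /or3P[/eqP->|/eqP->|/PG] //.
  by rewrite !inE => /and3P[].
move=> [//|k] ak kG; have [||A [AG Ak hA]] := hP k; [lia|lia|].
have xA : x \notin A.
  by apply: contraTN isT => /(subsetP AG); rewrite !inE eqxx /= andbF.
have yA : y \notin A by apply: contraTN isT => /(subsetP AG); rewrite !inE eqxx.
exists (x |: A); split.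
- by rewrite subUset sub1set xG (subset_trans AG) // !(subset_trans (subD1set _ _)).
- by rewrite cardsU1 xA Ak.
rewrite pprod_cons /= !inE eqxx (negPf yx) (negPf yA) /= subr0 mul1r -[RHS]hA.
by apply: pprod_congr => z zP; rewrite !inE; case: eqP zP xP => // -> ->.
Qed.

End PairProducts.

(** * Adjacency sums of pair products on a level *)

Definition pairing (T : finType) (X : {set T}) (a b : nat) (P : seq (T * T)) : Prop :=
  [/\ uniq (vert P), balanced X P, npairs X P = a & npairs (~: X) P = b].

(* The coefficient with which A_1 sends level l to level j in a module with a pairs
   inside x0 and b pairs outside. *)
Definition adj_coef (C : nzRingType) (m a b j l : nat) : C :=
  (-1) ^+ (a + b) * ((j + l == m)%N%:R * (j.+1%:R - b%:R)
                     + (j + l + 1 == m)%N%:R * ((m - j)%:R - a%:R)).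

Section LevelSums.
Variables (C : numFieldType) (T : finType) (m : nat) (X : {set T}).
Hypotheses (cardT : #|T| = m.*2.+1) (cardX : #|X| = m).
Implicit Types (A B D G : {set T}) (P : seq (T * T)).
Local Notation h := (@pprod C T).

Lemma balancedC G P : balanced (~: G) P = balanced G P.
Proof. by apply: eq_all => p; rewrite !inE; case: (p.1 \in G); case: (p.2 \in G). Qed.

Lemma size_pairing a b P : pairing X a b P -> size P = (a + b)%N.
Proof.
case=> _ _ <- <-; rewrite -(count_predC (fun p => p.1 \in X) P).
by congr (_ + _)%N; apply: eq_count => p /=; rewrite inE.
Qed.

Lemma pairing_self P : uniq (vert P) -> balanced X P ->
  pairing X (npairs X P) (npairs (~: X) P) P.
Proof. by []. Qed.

Lemma card_inside_outside A : #|A| = (#|A :&: X| + #|A :&: ~: X|)%N.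
Proof. by rewrite -(cardsID X A) setDE. Qed.

Lemma card_meet_setC A : (#|A :&: X| + #|~: A :&: X|)%N = m.
Proof. by rewrite -cardX -(cardsID A X) setDE !(setIC X). Qed.

(** The four bounds come from [pprod_small] applied to A and to its complement, each inside X and
    outside X. *)
Lemma pairing_levels a b P A : #|A| = m -> pairing X a b P -> h P A != 0 ->
  [/\ (a <= #|A :&: X|)%N, (a + #|A :&: X| <= m)%N, (b <= #|A :&: X|.+1)%N
    & (b + #|A :&: X| <= m)%N].
Proof.
move=> cA PP hP; have sP := size_pairing PP; case: PP => uP bP aP bP'.
have hP' : h P (~: A) != 0 by rewrite pprod_setC mulf_neq0 // expf_neq0 // oppr_eq0 oner_eq0.
have small G D : balanced G P -> h P D != 0 -> (npairs G P <= #|D :&: G|)%N.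
  by move=> bG; apply: contraR; rewrite -ltnNge => lt; rewrite (pprod_small C uP bG lt).
have := small _ _ bP hP; have := small _ _ bP hP'.
have bC : balanced (~: X) P by rewrite balancedC.
have := small _ _ bC hP; have := small _ _ bC hP'.
have := card_inside_outside A; have := card_inside_outside (~: A).
have := cardsC A; have := card_inside_outside [set: T].
rewrite !setTI cardsT cardT cardX cA aP bP'.
by move=> *; have := card_meet_setC A; split; lia.
Qed.

(** The complement of A has m + 1 points, so every neighbour of A is that complement with one point
    deleted. *)
Lemma sum_disj_adj (F : {set T} -> C) A : #|A| = m ->
  \sum_(D | disj_adj m A D) F D = \sum_(x in ~: A) F (~: A :\ x).
Proof.
move=> cA; rewrite -(big_imset F (h := fun x => ~: A :\ x)) /=; last first.
  move=> x y xA yA /setP/(_ x); rewrite !inE eqxx /=.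
  by move: xA; rewrite inE => -> /esym; rewrite andbT => /negbFE/eqP.
apply: eq_bigl => D; apply/idP/imsetP => [AD|[x]]; last first.
  by rewrite inE => xA ->; apply: disj_adj_setCD1.
case/and3P: (AD) => _ /eqP cD dAD.
have sDA : D \subset ~: A by rewrite -disjoints_subset disjoint_sym.
have cC := cardsC A; rewrite cA cardT in cC.
have [x] : exists x, x \in ~: A :\: D.
  apply/set0Pn; rewrite -card_gt0 cardsD (setIidPr sDA) cD; lia.
rewrite inE => /andP[xD xA]; exists x => //.
apply/eqP; rewrite eqEcard; apply/andP; split.
  apply/subsetP => y yD; rewrite in_setD1 (subsetP sDA) // andbT.
  by apply: contraNneq xD => <-.
have := cardsD1 x (~: A); rewrite xA cD /=; lia.
Qed.

(** The neighbours are split by the side of the deleted point: for A on level j, a point of X leads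
    to level m - j - 1 and any other point to level m - j. Each part is an instance of [pprod_down]
    for the complement of A, whose sign is that of [pprod_setC]. *)
Lemma sum_adj_pprod a b P A l : #|A| = m -> pairing X a b P ->
  \sum_(D | disj_adj m A D) h P D * (#|D :&: X| == l)%:R
    = adj_coef C m a b #|A :&: X| l * h P A.
Proof.
move=> cA PP; have sP := size_pairing PP; case: PP => uP bP aP bP'.
have cAX : #|~: A :&: X| = (m - #|A :&: X|)%N.
  by have := card_meet_setC A; lia.
have cAX' : #|~: A :&: ~: X| = #|A :&: X|.+1.
  have := card_inside_outside (~: A); have := cardsC A; rewrite cA cardT cAX.
  have := subset_leq_card (subsetIl A X); rewrite cA; lia.
have leX := subset_leq_card (subsetIl A X); rewrite cA in leX.
have Dlev x : x \in ~: A ->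
    #|(~: A :\ x) :&: X| = (m - #|A :&: X| - (x \in X))%N.
  move=> xA; have -> : (~: A :\ x) :&: X = (~: A :&: X) :\ x.
    by apply/setP => y; rewrite !inE andbA.
  by have := cardsD1 x (~: A :&: X); rewrite cAX in_setI xA /=; lia.
rewrite sum_disj_adj // (bigID (mem X)) /=.
have bC : balanced (~: X) P by rewrite balancedC.
have in1 : \sum_(x in ~: A | x \in X)
    h P (~: A :\ x) * (#|(~: A :\ x) :&: X| == l)%:R
  = (#|A :&: X| + l + 1 == m)%N%:R * (((m - #|A :&: X|)%:R - a%:R) * h P (~: A)).
  rewrite -cAX -aP -pprod_down // mulr_sumr; apply: eq_big => x.
    by rewrite !(in_setI, in_setC).
  case/andP => xA xX; rewrite mulrC Dlev // xX; congr (_%:R * _).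
  (* Positivity makes the truncated subtraction of 1 from m - #|A :&: X| exact. *)
  have : (0 < #|~: A :&: X|)%N by rewrite card_gt0; apply/set0Pn; exists x; rewrite in_setI xA.
  rewrite cAX; lia.
have in2 : \sum_(x in ~: A | x \notin X)
    h P (~: A :\ x) * (#|(~: A :\ x) :&: X| == l)%:R
  = (#|A :&: X| + l == m)%N%:R * ((#|A :&: X|.+1%:R - b%:R) * h P (~: A)).
  rewrite -cAX' -bP' -pprod_down // mulr_sumr; apply: eq_big => x.
    by rewrite !(in_setI, in_setC).
  case/andP => xA xX; rewrite mulrC Dlev // (negPf xX) subn0; congr (_%:R * _).
  lia.
rewrite in1 in2 pprod_setC sP /adj_coef; ring.
Qed.

(* For x notin B, replace the factor [x in A] of a monomial by its average over the
   free points F: the differences [x in A] - [y in A] extend P by a pair, and the sum of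
   [y in A] over y in F is constant on a level. This lowers the degree of the monomial. *)
Lemma monomial_reduction G P B A x : uniq (vert P) -> balanced G P -> x \in G ->
  x \notin B -> x \notin vert P -> [disjoint B & vert P] ->
  let F := G :\: (B :|: [set y in vert P]) in
  #|F|%:R * ((x |: B \subset A)%:R * h P A)
   = \sum_(y in F :\ x) (B \subset A)%:R * h ((x, y) :: P) A
     + (#|A :&: G|%:R - #|B :&: G|%:R - (npairs G P)%:R) * ((B \subset A)%:R * h P A).
Proof.
move=> uP bP xG xB xP dB F.
rewrite subUset sub1set.
have [BA|_] := boolP (B \subset A); last first.
  by rewrite andbF big1 ?mul0r ?mulr0 ?addr0 // => y _; rewrite mul0r.
rewrite andbT !mul1r.
have E : #|A :&: F|%:R * h P A = (#|A :&: G|%:R - #|B :&: G|%:R - (npairs G P)%:R) * h P A.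
  rewrite mulrBl [(npairs _ _)%:R * _]mulrC -pprod_card_vert // mulrC.
  rewrite [h P A * (count _ _)%:R]mulrC -mulrBl mulrC.
  congr (_ * _).
  have -> : count (fun y => y \in A :&: G) (vert P) = #|A :&: G :&: [set y in vert P]|.
    rewrite -size_filter -(card_uniqP _); last exact: filter_uniq.
    by apply: eq_card => y; rewrite mem_filter [RHS]in_setI [y \in [set _ in _]]inE.
  have dis : (B :&: G) :&: (A :&: G :&: [set y in vert P]) = set0.
    apply/setP => y; rewrite !inE; apply/negP => /andP[/andP[yB _] /andP[_ yP]].
    by rewrite (disjointFr dB yB) in yP.
  have := cardsU (B :&: G) (A :&: G :&: [set y in vert P]).
  rewrite dis cards0 subn0 => cU.
  have := cardsID ((B :&: G) :|: (A :&: G :&: [set y in vert P])) (A :&: G).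
  have -> : (A :&: G) :&: ((B :&: G) :|: (A :&: G :&: [set y in vert P])) =
     (B :&: G) :|: (A :&: G :&: [set y in vert P]).
    apply/setIidPr; rewrite subUset (setSI _ BA) /=.
    by rewrite -setIA setIA subsetIl.
  have -> : (A :&: G) :\: ((B :&: G) :|: (A :&: G :&: [set y in vert P])) = A :&: F.
    apply/setP => y; rewrite !inE.
    by case: (y \in A); case: (y \in G); rewrite ?andbF ?andbT.
  by rewrite cU => <-; rewrite !natrD; ring.
rewrite -E.
have -> : \sum_(y in F :\ x) 1 * h ((x, y) :: P) A
    = \sum_(y in F) ((x \in A)%:R - (y \in A)%:R) * h P A.
  rewrite [RHS](bigD1 x) /=; last by rewrite !inE (negPf xB) (negPf xP).
  rewrite subrr mul0r add0r; apply: eq_big => y; first by rewrite !inE andbC.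
  by rewrite mul1r pprod_cons.
rewrite -mulr_suml sumrB sumr_const.
have -> : \sum_(y in F) (y \in A)%:R = #|A :&: F|%:R :> C.
  rewrite -sum1_card natr_sum [RHS]big_mkcond [LHS]big_mkcond /=.
  by apply: eq_bigr => y _; rewrite in_setI; case: (y \in A); case: (y \in F).
rewrite -[_ *+ #|F|]mulr_natl; ring.
Qed.

End LevelSums.

(** * The modules of the Terwilliger algebra *)

Section GeneratedAlgebra.
Variables (C : comNzRingType) (m : nat).
Local Notation T := (@Talg C m).

Lemma word_cat (u v : seq 'I_m.+2) : word C (u ++ v) = word C u *m word C v.
Proof.
elim: u => [|g u IH]; first by rewrite mul1mx.
by rewrite -[word C (g :: u)]/(gen C g *m word C u) -mulmxA -IH.
Qed.

Lemma Talg0 : T 0.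
Proof. by exists [::]; rewrite big_nil. Qed.

Lemma Talg1 : T 1%:M.
Proof. by exists [:: (1, [::])]; rewrite big_seq1 scale1r. Qed.

Lemma TalgD M N : T M -> T N -> T (M + N).
Proof. by case=> s -> [t ->]; exists (s ++ t); rewrite big_cat. Qed.

Lemma TalgZ a M : T M -> T (a *: M).
Proof.
case=> s ->; exists [seq (a * p.1, p.2) | p <- s].
by rewrite big_map scaler_sumr; apply: eq_bigr => p _; rewrite scalerA.
Qed.

Lemma TalgM M N : T M -> T N -> T (M *m N).
Proof.
case=> s -> [t ->]; exists [seq (p.1 * q.1, p.2 ++ q.2) | p <- s, q <- t].
rewrite big_allpairs_dep mulmx_suml; apply: eq_bigr => p _.
rewrite mulmx_sumr; apply: eq_bigr => q _.
by rewrite word_cat -scalemxAl -scalemxAr scalerA.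
Qed.

Lemma Talg_gen (g : 'I_m.+2) : T (gen C g).
Proof. by exists [:: (1, [:: g])]; rewrite big_seq1 scale1r /word /= mulmx1. Qed.

Lemma Talg_A1 : T (A1 C m).
Proof. exact: (Talg_gen ord0). Qed.

Lemma Talg_Estar d : (d <= m)%N -> T (Estar C m d).
Proof.
move=> dm; have dm' : (d.+1 < m.+2)%N by [].
exact: (Talg_gen (Ordinal dm')).
Qed.

End GeneratedAlgebra.

Lemma card_x0 m : #|x0 m| = m.
Proof.
rewrite -sum1_card (eq_bigl (fun i : Sset m => (i < m)%N)); last by move=> i; rewrite inE.
by rewrite -(big_ord_widen _ (fun=> 1%N)) ?sum1_card ?card_ord //; lia.
Qed.

Lemma cardS m : #|{: Sset m}| = m.*2.+1.
Proof. exact: card_ord. Qed.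

Definition vtx m (i : 'I_(nX m)) : {set Sset m} := val (enum_val i : Xv m).

Definition lev m (i : 'I_(nX m)) : nat := #|vtx i :&: x0 m|.

Lemma card_vtx m (i : 'I_(nX m)) : #|vtx i| = m.
Proof. by apply/eqP; exact: (valP (enum_val i : Xv m)). Qed.

Lemma lev_le m (i : 'I_(nX m)) : (lev i <= m)%N.
Proof. by rewrite -[X in (_ <= X)%N](card_vtx i); apply/subset_leq_card/subsetIl. Qed.

Lemma vtx_exists m (D : {set Sset m}) : #|D| = m -> exists i, @vtx m i = D.
Proof.
move=> /eqP cD; exists (enum_rank (Sub D cD : Xv m)).
by rewrite /vtx enum_rankK.
Qed.

Lemma vtx_inj m : injective (@vtx m).
Proof. by move=> i j /val_inj /enum_val_inj. Qed.

Lemma sum_vtx (C : nmodType) m (F : {set Sset m} -> C) :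
  \sum_(i < nX m) F (vtx i) = \sum_(D : {set Sset m} | #|D| == m) F D.
Proof.
rewrite -(big_imset F (h := @vtx m) (A := predT)) /=; last by move=> i j _ _ /vtx_inj.
apply: eq_bigl => D; apply/imsetP/idP => [[i _ ->]|/eqP /vtx_exists [i <-]].
  by rewrite card_vtx.
by exists i.
Qed.

Section Modules.
Variables (C : numFieldType) (m : nat).
Local Notation h := (@pprod C (Sset m)).
Local Notation T := (@Talg C m).
Local Notation pairing := (pairing (x0 m)).
Implicit Type P : seq (Sset m * Sset m).

Definition levmx P : 'M[C]_(nX m, m.+1) :=
  \matrix_(i, q) (h P (vtx i) * (lev i == q)%:R).

Definition coefA (a b : nat) : 'M[C]_(m.+1) := \matrix_(j, l) adj_coef C m a b j l.

Definition coefE (d : nat) : 'M[C]_(m.+1) :=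
  \matrix_(j, l) ((j == l) && (lev_dist m j == d))%:R.

Lemma A1_levmx a b P : pairing a b P -> A1 C m *m levmx P = levmx P *m coefA a b.
Proof.
move=> PP; apply/matrixP => i q; rewrite !mxE.
pose j : 'I_m.+1 := Ordinal (lev_le i : (lev i < m.+1)%N).
rewrite [RHS](bigD1 j) //= [X in _ = _ + X]big1 ?addr0 => [|l lj]; last first.
  by rewrite !mxE -[lev i]/(val j) val_eqE eq_sym (negPf lj) mulr0 mul0r.
rewrite !mxE eqxx mulr1 mulrC -(sum_adj_pprod C (cardS m) (card_x0 m) q (card_vtx i) PP).
under eq_bigr do rewrite !mxE -!/(vtx _).
pose F (D : {set Sset m}) : C := (oadj (vtx i) D)%:R * (h P D * (#|D :&: x0 m| == q)%:R).
rewrite -/(lev _) (sum_vtx F) [RHS]big_mkcond [LHS]big_mkcond /=.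
apply: eq_bigr => D _; rewrite /F /oadj /disj_adj.
by case: (#|D| == m); case: (#|vtx i| == m); case: [disjoint vtx i & D];
   rewrite /= ?mul1r ?mul0r.
Qed.

Lemma EstarE d (i j : 'I_(nX m)) :
  Estar C m d i j = ((i == j) && (lev_dist m (lev i) == d))%:R.
Proof.
by rewrite mxE odistE ?card_x0 ?card_vtx // -/(vtx i) setIC.
Qed.

Lemma Estar_levmx d P : Estar C m d *m levmx P = levmx P *m coefE d.
Proof.
apply/matrixP => i q; rewrite !mxE.
pose j : 'I_m.+1 := Ordinal (lev_le i : (lev i < m.+1)%N).
rewrite [RHS](bigD1 j) //= [X in _ = _ + X]big1 ?addr0 => [|l lj]; last first.
  by rewrite !mxE -[lev i]/(val j) val_eqE eq_sym (negPf lj) mulr0 mul0r.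
rewrite (bigD1 i) //= big1 ?addr0 => [|k ki]; last first.
  by rewrite EstarE eq_sym (negPf ki) mul0r.
rewrite EstarE !mxE eqxx /= -val_eqE /=.
by rewrite (eqxx (lev i)) mulr1 -mulnb natrM mulrCA [_ * (lev i == q)%:R]mulrC.
Qed.

(** The matrix [c a b] sees P only through its counts, so all P with equal counts give the same
    action. Rows of [c a b] at levels where every such h_P vanishes remain arbitrary. *)
Definition acts (M : 'M[C]_(nX m)) (c : nat -> nat -> 'M[C]_(m.+1)) : Prop :=
  T M /\ forall a b P, pairing a b P -> M *m levmx P = levmx P *m c a b.

Lemma acts_A1 : acts (A1 C m) coefA.
Proof. by split=> [|a b P]; [exact: Talg_A1 | exact: A1_levmx]. Qed.

Lemma acts_mul M N c c' : acts M c -> acts N c' ->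
  acts (M *m N) (fun a b => c a b *m c' a b).
Proof.
case=> TM cM [TN cN]; split; first exact: TalgM.
by move=> a b P PP; rewrite -mulmxA (cN _ _ _ PP) !mulmxA (cM _ _ _ PP).
Qed.

Lemma acts_lin M N x c c' : acts M c -> acts N c' ->
  acts (x *: M + N) (fun a b => x *: c a b + c' a b).
Proof.
case=> TM cM [TN cN]; split; first by apply: TalgD => //; exact: TalgZ.
by move=> a b P PP; rewrite mulmxDl -scalemxAl (cM _ _ _ PP) (cN _ _ _ PP) mulmxDr scalemxAr.
Qed.

Lemma acts_ext M c c' : acts M c -> (forall a b, c a b = c' a b) -> acts M c'.
Proof. by case=> TM cM e; split=> // a b P PP; rewrite (cM _ _ _ PP) e. Qed.

Lemma Talg_acts M : T M -> exists c, acts M c.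
Proof.
case=> s ->.
suff H (w : seq 'I_m.+2) : exists c, acts (word C w) c.
  elim: s => [|[x w] s [c IH]].
    exists (fun _ _ => 0); rewrite big_nil; split; first exact: Talg0.
    by move=> a b P _; rewrite mul0mx mulmx0.
  have [cw Hw] := H w; rewrite big_cons /=.
  by eexists; apply: acts_lin Hw IH.
elim: w => [|g w [c IH]].
  exists (fun _ _ => 1%:M); split; first exact: Talg1.
  by move=> a b P _; rewrite mul1mx mulmx1.
suff [cg Hg] : exists c, acts (gen C g) c.
  by eexists; apply: acts_mul Hg IH.
case: g => [[|d] dm]; first by exists coefA; exact: acts_A1.
exists (fun _ _ => coefE d); split; first exact: Talg_Estar.
by move=> a b P _; exact: Estar_levmx.
Qed.

End Modules.

(** * Blocks *)

Section Blocks.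
Variable m : nat.
Implicit Type b : block m.

Definition bdeg b : nat := (val b).1.

Definition bidx b : nat := (val b).2.

(* The levels in the support of the block are blow b, ..., blow b + bdeg b. *)
Definition blow b : nat := (m - bdeg b)./2.

(** The support from max(a, b-1) to m - max(a, b) has length d + 1 with m - d = 2a if b <= a, and m
    - d = 2b - 1 if b > a. So the parity of m - d tells which count is forced by d; the other count
    is the copy index, free from 0 to [blow b]. *)
Definition bA b : nat := if odd (m - bdeg b) then bidx b else blow b.

Definition bB b : nat := if odd (m - bdeg b) then (blow b).+1 else bidx b.

Lemma bdeg_le b : (bdeg b <= m)%N.
Proof. exact: ltn_ord (val b).1. Qed.

Lemma bidx_le b : (bidx b <= blow b)%N.
Proof.
have lt : (bidx b < mult m (bdeg b))%N := valP b.
have := bdeg_le b; rewrite /mult in lt; rewrite /blow; lia.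
Qed.

Lemma block_bounds b : [/\ (bA b <= blow b)%N, (bB b <= (blow b).+1)%N,
  (bA b + (blow b + bdeg b) <= m)%N & (bB b + (blow b + bdeg b) <= m)%N].
Proof.
have lt := bdeg_le b; have k := bidx_le b.
have := odd_double_half (m - bdeg b).
by move: k; rewrite /bA /bB /blow; case: (odd _); rewrite /= => *; split; lia.
Qed.

Lemma block_level_lt b (p : 'I_(bdim b)) : (blow b + p < m.+1)%N.
Proof.
have [_ _ h _] := block_bounds b; have lt : (p < (bdeg b).+1)%N := ltn_ord p.
lia.
Qed.

Definition blevel b (p : 'I_(bdim b)) : 'I_m.+1 := Ordinal (block_level_lt p).

Lemma blevel_inj b : injective (@blevel b).
Proof. by move=> p q /(congr1 val) /= /addnI /val_inj. Qed.

Lemma blevel_codom b (j : 'I_m.+1) : (blow b <= j)%N -> (j <= blow b + bdeg b)%N ->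
  exists p, j = @blevel b p.
Proof.
move=> loj jhi; have lt : (j - blow b < (bdeg b).+1)%N by lia.
by exists (Ordinal lt : 'I_(bdim b)); apply: val_inj; rewrite /= subnKC.
Qed.

(** The hypotheses are the bounds of [pairing_levels], so every level where some h_P is nonzero
    belongs to a block with the counts of P. *)
Lemma block_exists (a b j : nat) : (a <= j)%N -> (a + j <= m)%N -> (b <= j.+1)%N ->
  (b + j <= m)%N -> exists bl, [/\ bA bl = a, bB bl = b, (blow bl <= j)%N
    & (j <= blow bl + bdeg bl)%N].
Proof.
move=> aj ajm bj bjm.
have [ba|ab] := leqP b a.
  (* For b <= a the support runs from a to m - a. *)
  have dlt : (m - a.*2 < m.+1)%N by lia.
  have klt : (b < m.+1)%N by lia.
  have kmult : (Ordinal klt < mult m (Ordinal dlt))%N by rewrite /mult /=; lia.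
  exists (exist _ (Ordinal dlt, Ordinal klt) kmult).
  have e : (m - (m - a.*2) = a.*2)%N by lia.
  by rewrite /bA /bB /blow /bdeg /bidx /= e odd_double doubleK; split=> //; lia.
(* For b > a the support runs from b - 1 to m - b. *)
have dlt : (m - b.*2.-1 < m.+1)%N by lia.
have klt : (a < m.+1)%N by lia.
have kmult : (Ordinal klt < mult m (Ordinal dlt))%N by rewrite /mult /=; lia.
exists (exist _ (Ordinal dlt, Ordinal klt) kmult).
have e : (m - (m - b.*2.-1) = (b.-1).*2.+1)%N by lia.
by rewrite /bA /bB /blow /bdeg /bidx /= e /= odd_double /= uphalf_double; split=> //; lia.
Qed.

(** The counts determine the parity of m - d, which is even exactly when [bB b <= bA b]; the degree
    and the copy index follow. *)
Lemma block_eq b b' : bA b = bA b' -> bB b = bB b' -> b = b'.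
Proof.
move=> eA eB.
have k := bidx_le b; have k' := bidx_le b'.
have lt := bdeg_le b; have lt' := bdeg_le b'.
have o := odd_double_half (m - bdeg b); have o' := odd_double_half (m - bdeg b').
suff [e1 e2] : bdeg b = bdeg b' /\ bidx b = bidx b'.
  apply: val_inj; rewrite (surjective_pairing (val b)) (surjective_pairing (val b')).
  by congr (_, _); apply: val_inj.
move: eA eB k k' o o'; rewrite /bA /bB /blow.
by case: (odd _); case: (odd _); rewrite /= => *; split; lia.
Qed.

End Blocks.

Lemma sum_codom (C : nmodType) (I J : finType) (f : I -> J) (F : J -> C) :
  injective f -> (forall j, j \notin codom f -> F j = 0) ->
  \sum_j F j = \sum_i F (f i).
Proof.
move=> finj F0.
rewrite -(big_imset F (h := f) (A := predT)) /=; last by move=> i j _ _ /finj.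
rewrite [RHS]big_mkcond; apply: eq_bigr => j _.
case: ifPn => // jf; apply: F0; apply: contra jf => /codomP[i ->].
exact: imset_f.
Qed.

(** * The block representations and their joint faithfulness *)

Section Representation.
Variables (C : numFieldType) (m : nat).
Local Notation h := (@pprod C (Sset m)).
Local Notation T := (@Talg C m).
Local Notation pairing := (pairing (x0 m)).

(** At a vertex of level j where h_P is 1, the row of M *m [levmx C P] is row j of the acting
    matrix. One such vertex per level of the block therefore reads off the whole action. *)
Lemma block_points (b : block m) : exists P, pairing (bA b) (bB b) P /\
  exists y : 'I_(bdim b) -> 'I_(nX m),
    forall p, lev (y p) = blevel p /\ h P (vtx (y p)) = 1.
Proof.
have [bd1 bd2 bd3 bd4] := block_bounds b.
have cX := card_x0 m.
have cX' : #|~: x0 m| = m.+1.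
  by have := card_setC_odd (cardS m) (x0 m); rewrite cX; move: #|_| => n; lia.
have [|P [sP uP PX hP]] := @pairs_exist C _ (bA b) (x0 m); first by rewrite cX; lia.
have [|Q [sQ uQ QX hQ]] := @pairs_exist C _ (bB b) (~: x0 m); first by rewrite cX'; lia.
have QX' z : z \in vert Q -> z \notin x0 m by move/QX; rewrite inE.
have mem1 (R : seq (Sset m * Sset m)) p : p \in R -> p.1 \in vert R /\ p.2 \in vert R.
  by move=> pR; split; apply/flattenP; exists [:: p.1; p.2];
    rewrite ?map_f // !inE eqxx ?orbT.
exists (P ++ Q); split.
  split.
  - rewrite vert_cat cat_uniq uP uQ andbT /=; apply/hasPn => z zQ.
    by apply: contra (QX' _ zQ) => /PX.
  - rewrite /balanced all_cat; apply/andP; split; apply/allP => p /mem1[p1 p2].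
      by rewrite !PX.
    by rewrite (negPf (QX' _ p1)) (negPf (QX' _ p2)).
  - rewrite /npairs count_cat -sP.
    rewrite (_ : count _ Q = 0%N) ?addn0; last first.
      by apply/eqP; rewrite -leqn0 leqNgt -has_count; apply/hasPn => p /mem1[/QX'].
    by apply/eqP; rewrite -all_count; apply/allP => p /mem1[/PX].
  - rewrite /npairs count_cat -sQ.
    rewrite (_ : count _ P = 0%N) ?add0n; last first.
      apply/eqP; rewrite -leqn0 leqNgt -has_count; apply/hasPn => p /mem1[/PX].
      by rewrite in_setC negbK.
    by apply/eqP; rewrite -all_count; apply/allP => p /mem1[/QX].
suff H p : exists i, lev i = @blevel _ b p /\ h (P ++ Q) (vtx i) = 1.
  have [y Hy] := fin_all_exists H.
  by exists y.
have lt : (p < (bdeg b).+1)%N := ltn_ord p.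
(* The vertex is the union of A inside [x0 m] and B outside; [block_bounds] puts both sizes in the
   ranges allowed by [pairs_exist]. *)
have [||A [AX cA hA]] := hP (blow b + p)%N; [lia|by rewrite cX; lia|].
have [||B [BX cB hB]] := hQ (m - (blow b + p))%N; [lia|by rewrite cX'; lia|].
have nA z : z \in B -> z \in A = false.
  by move/(subsetP BX); rewrite inE => zX; apply: contraNF zX => /(subsetP AX).
have nB z : z \in A -> z \in B = false.
  by move=> zA; apply/negP => /nA; rewrite zA.
have cAB : #|A :|: B| = m.
  rewrite cardsU (_ : A :&: B = set0); first by rewrite cards0 cA cB; lia.
  by apply/setP => z; rewrite !inE; apply/negP => /andP[/nB ->].
have [i Vi] := vtx_exists cAB.
exists i; split.
  rewrite /lev Vi setIUl (setIidPl AX) (_ : B :&: x0 m = set0) ?setU0 //.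
  apply/setP => z; rewrite in_setI in_set0; apply/negP => /andP[/(subsetP BX)].
  by rewrite in_setC => /negPf ->.
rewrite Vi pprod_cat (_ : h P _ = 1); last first.
  rewrite -hA; apply: pprod_congr => z /PX zX; rewrite in_setU.
  suff -> : z \in B = false by rewrite orbF.
  by apply/negP => /(subsetP BX); rewrite in_setC zX.
rewrite mul1r -hB; apply: pprod_congr => z /QX' zX; rewrite in_setU.
suff -> : z \in A = false by [].
by apply: contraNF zX => /(subsetP AX).
Qed.

Lemma levmx_mulE P (c : 'M[C]_(m.+1)) i (j q : 'I_m.+1) : lev i = j :> nat ->
  (levmx C P *m c) i q = h P (vtx i) * c j q.
Proof.
move=> ij; rewrite mxE (bigD1 j) //= big1 ?addr0 => [|l lj].
  by rewrite mxE ij eqxx mulr1.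
by rewrite mxE ij val_eqE eq_sym (negPf lj) mulr0 mul0r.
Qed.

Lemma levmx_off_block (b : block m) P i (j : 'I_m.+1) :
  pairing (bA b) (bB b) P -> j \notin codom (@blevel _ b) -> levmx C P i j = 0.
Proof.
move=> PP jb; rewrite mxE; have [ij|_] := eqVneq (lev i) j; last by rewrite mulr0.
have [->|hn] := eqVneq (h P (vtx i)) 0; first by rewrite mul0r.
have [l1 l2 l3 l4] := pairing_levels (cardS m) (card_x0 m) (card_vtx i) PP hn.
rewrite -/(lev i) ij in l1 l2 l3 l4.
have [bl [eA eB lo hi]] := block_exists l1 l2 l3 l4.
have e := block_eq eA eB; rewrite {}e in lo hi.
have [p jp] := blevel_codom lo hi.
by case/negP: jb; rewrite jp codom_f.
Qed.

Definition submx_block (b : block m) (c : nat -> nat -> 'M[C]_(m.+1)) : 'M[C]_(bdim b) :=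
  mxsub (@blevel m b) (@blevel m b) (c (bA b) (bB b)).

(** Reading entries at the vertices of [block_points] makes phi linear on all matrices and
    independent of the choice of c. By the last clause the rows of the support vanish outside it, so
    that truncation to the block will respect products. *)
Lemma block_rep (b : block m) : exists phi : 'M[C]_(nX m) -> 'M[C]_(bdim b),
  [/\ forall x M N, phi (x *: M + N) = x *: phi M + phi N,
      forall (M : 'M[C]_(nX m)) c, acts M c -> phi M = submx_block b c &
      forall (M : 'M[C]_(nX m)) c, acts M c -> forall p j, j \notin codom (@blevel m b) ->
        c (bA b) (bB b) (@blevel m b p) j = 0].
Proof.
have [P [PP [y Hy]]] := block_points b.
have key (M : 'M[C]_(nX m)) c p q : acts M c ->
    (M *m levmx C P) (y p) q = c (bA b) (bB b) (blevel p) q.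
  move=> [_ cM]; have [lp hp] := Hy p.
  by rewrite (cM _ _ _ PP) (levmx_mulE _ _ _ lp) hp mul1r.
exists (fun M => \matrix_(p, q) (M *m levmx C P) (y p) (blevel q)); split.
- by move=> x M N; apply/matrixP => p q; rewrite mulmxDl -scalemxAl !mxE.
- by move=> M c cM; apply/matrixP => p q; rewrite mxE (key _ _ _ _ cM) mxE.
move=> M c cM p j jb; rewrite -(key _ _ _ _ cM) mxE big1 // => i _.
by rewrite (levmx_off_block _ PP jb) mulr0.
Qed.

Definition monmx (B : {set Sset m}) P : 'M[C]_(nX m, m.+1) :=
  \matrix_(i, q) ((B \subset vtx i)%:R * h P (vtx i) * (lev i == q)%:R).

(** Induction on the size of B, for all P at once: [monomial_reduction] trades a point x of B for a
    new pair (x, y) or for a scalar depending on the level. Both points of the new pair lie on the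
    side G of x, which keeps P balanced. *)
Lemma monmx_kill (M : 'M[C]_(nX m)) :
  (forall P, uniq (vert P) -> balanced (x0 m) P -> M *m levmx C P = 0) ->
  forall (B : {set Sset m}) P, uniq (vert P) -> balanced (x0 m) P -> [disjoint B & vert P] ->
  M *m monmx B P = 0.
Proof.
move=> killP B; move Ek: #|B| => k; elim: k B Ek => [|k IH] B cB P uP bP dB.
  rewrite -[RHS](killP P) //; congr (_ *m _); apply/matrixP => i q.
  by rewrite !mxE (cards0_eq cB) sub0set mul1r.
have [x xB] : exists x, x \in B by apply/set0Pn; rewrite -card_gt0 cB.
pose B' := B :\ x; have cB' : #|B'| = k by have := cardsD1 x B; rewrite xB cB => -[].
pose G := if x \in x0 m then x0 m else ~: x0 m.
have xG : x \in G by rewrite /G; case: ifPn; rewrite ?inE.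
have bG : balanced G P by rewrite /G; case: ifP; rewrite ?balancedC.
have xB' : x \notin B' by rewrite !inE eqxx.
have xP : x \notin vert P by rewrite (disjointFr dB xB).
have dB' : [disjoint B' & vert P] by apply: disjointWl dB; apply: subD1set.
pose F := G :\: (B' :|: [set y in vert P]).
(* The point x itself lies in F, so #|F| can be cancelled in characteristic zero. *)
have F0 : #|F|%:R != 0 :> C.
  rewrite pnatr_eq0 -lt0n card_gt0; apply/set0Pn; exists x.
  by rewrite !inE eqxx (negPf xP).
pose g (q : nat) : nat := if x \in x0 m then q else (m - q)%N.
have gE i q : lev i = q -> #|vtx i :&: G| = g q.
  rewrite /g /G; case: ifP => _ // <-.
  by rewrite -setDE cardsD card_vtx.
(* The scalar of [monomial_reduction] depends only on the level, hence becomes a diagonal factor on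
   the right, where it does not interfere with M. *)
pose D : 'M[C]_m.+1 := diag_mx (\row_q ((g q)%:R - #|B' :&: G|%:R - (npairs G P)%:R)).
have E : #|F|%:R *: monmx B P
    = \sum_(y in F :\ x) monmx B' ((x, y) :: P) + monmx B' P *m D.
  apply/matrixP => i q; rewrite [RHS]mxE summxE mul_mx_diag !mxE.
  have [iq|iq] := eqVneq (lev i) q; last first.
    rewrite !mulr0 mul0r addr0 big1 // => y _.
    by rewrite mxE (negPf iq) mulr0.
  have := monomial_reduction C (vtx i) uP bG xG xB' xP dB'.
  rewrite /= (setD1K xB) (gE _ _ iq) -/F => e.
  rewrite !mulr1 e; congr (_ + _); last exact: mulrC.
  by apply: eq_bigr => y _; rewrite mxE iq eqxx mulr1.
suff : #|F|%:R *: (M *m monmx B P) = 0.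
  by move/eqP; rewrite scaler_eq0 (negPf F0) => /eqP.
rewrite scalemxAr E mulmxDr mulmxA (IH _ cB') // mul0mx addr0 mulmx_sumr.
apply: big1 => y; rewrite !inE negb_or => /and3P[yx /andP[yB yP] yG].
apply: IH => //.
- by rewrite vert_cons /= inE negb_or eq_sym yx xP yP.
- rewrite /= bP andbT; move: yG; rewrite /G; case: ifP => xX; rewrite ?in_setC /= => yX.
    by rewrite yX.
  by rewrite (negPf yX).
rewrite vert_cons; apply/pred0Pn => -[z /=]; rewrite !inE.
case/andP => /andP[zx zB] /or3P[/eqP zx'|/eqP zy|zP].
- by rewrite zx' eqxx in zx.
- by move: yB; rewrite -zy zx zB.
by rewrite (disjointFr dB zB) in zP.
Qed.

(** A level where h_P is nonzero lies in a block; there the row of c is zero on the support by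
    assumption and off it by [block_rep]. So M kills every [levmx C P], and then every monomial. *)
Lemma faithful (M : 'M[C]_(nX m)) : T M ->
  (forall b c, acts M c -> submx_block b c = 0) -> M = 0.
Proof.
move=> TM M0; have [c cM] := Talg_acts TM.
have kill P : uniq (vert P) -> balanced (x0 m) P -> M *m levmx C P = 0.
  move=> uP bP; have PP := pairing_self uP bP.
  rewrite (cM.2 _ _ _ PP); apply/matrixP => i q; rewrite [RHS]mxE.
  pose j : 'I_m.+1 := Ordinal (lev_le i : (lev i < m.+1)%N).
  rewrite (levmx_mulE _ _ _ (erefl : lev i = j)).
  have [->|hn] := eqVneq (h P (vtx i)) 0; first by rewrite mul0r.
  have [l1 l2 l3 l4] := pairing_levels (cardS m) (card_x0 m) (card_vtx i) PP hn.
  have [bl [eA eB lo hi]] := block_exists l1 l2 l3 l4.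
  have [p jp] := @blevel_codom _ bl j lo hi.
  rewrite jp -eA -eB.
  have [/codomP[q' ->]|qb] := boolP (q \in codom (@blevel _ bl)).
    by have /matrixP/(_ p q') := M0 bl c cM; rewrite !mxE => ->; rewrite mulr0.
  by have [_ [_ _ /(_ _ _ cM) ->]] := block_rep bl; rewrite ?mulr0.
apply/matrixP => r i; rewrite [RHS]mxE.
(* With no pairs and B a vertex, the monomial is the indicator of that vertex, since no other m-set
   contains B; this isolates column i of M. *)
have := monmx_kill kill (B := vtx i) (P := [::]) isT isT.
have -> : [disjoint vtx i & vert ([::] : seq (Sset m * Sset m))].
  by apply/pred0Pn => -[z /=]; rewrite andbF.
move/(_ isT)/matrixP/(_ r (Ordinal (lev_le i : (lev i < m.+1)%N))).
rewrite !mxE (bigD1 i) //= big1 => [|k ki].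
  by rewrite !mxE subxx pprod_nil eqxx !mulr1 addr0.
rewrite !mxE; case: (boolP (vtx i \subset vtx k)) => [sub|_]; last by rewrite !mul0r mulr0.
case/eqP: ki; apply: vtx_inj; apply/esym/eqP.
by rewrite eqEcard sub !card_vtx /=.
Qed.

End Representation.

(** * Surjectivity *)

Section Surjectivity.
Variables (C : numFieldType) (m : nat).
Hypothesis m_gt0 : (0 < m)%N.
Local Notation T := (@Talg C m).
Implicit Types (i j k l : 'I_m.+1) (f g : nat -> nat -> C).

(** The scalar is kept as a function of the counts because an element of the algebra acts on all
    modules at once. Isolating a block means finding an f that vanishes at the counts of all other
    blocks. *)
Definition attains j l f : Prop :=
  exists M : 'M[C]_(nX m), acts M (fun a b => f a b *: delta_mx j l).

Lemma attains_ext j l f g : attains j l f -> (forall a b, f a b = g a b) -> attains j l g.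
Proof. by case=> M aM e; exists M; apply: acts_ext aM _ => a b; rewrite e. Qed.

Lemma attains_mul j k l f g : attains j k f -> attains k l g ->
  attains j l (fun a b => f a b * g a b).
Proof.
case=> M aM [N aN]; exists (M *m N); apply: acts_ext (acts_mul aM aN) _ => a b.
by rewrite -scalemxAl -scalemxAr mul_delta_mx scalerA.
Qed.

Lemma attains_lin j l x f g : attains j l f -> attains j l g ->
  attains j l (fun a b => x * f a b + g a b).
Proof.
case=> M aM [N aN]; exists (x *: M + N); apply: acts_ext (acts_lin x aM aN) _ => a b.
by rewrite scalerA scalerDl.
Qed.

Lemma acts_level j : acts (Estar C m (lev_dist m j)) (fun _ _ => delta_mx j j).
Proof.
split=> [|a b P _]; first exact/Talg_Estar/lev_dist_le.
rewrite Estar_levmx; congr (_ *m _); apply/matrixP => k l; rewrite !mxE.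
have [<-|kl] := eqVneq k l => /=.
  by rewrite lev_dist_inj -1?ltnS // val_eqE andbb.
by case: eqP => // kj; case: eqP => // lj; rewrite kj lj eqxx in kl.
Qed.

Lemma attains_level j : attains j j (fun _ _ => 1).
Proof.
exists (Estar C m (lev_dist m j)).
by apply: acts_ext (acts_level j) _ => a b; rewrite scale1r.
Qed.

Lemma attains_adj j l : attains j l (fun a b => adj_coef C m a b j l).
Proof.
eexists; apply: acts_ext (acts_mul (acts_level j) (acts_mul (acts_A1 C m) (acts_level l))) _.
move=> a b; apply/matrixP => p q; rewrite !mxE (bigD1 j) //= big1 => [|k kj]; last first.
  by rewrite mxE (negPf kj) andbF mul0r.
rewrite addr0 !mxE (bigD1 l) //= big1 => [|k kl]; last first.
  by rewrite [delta_mx _ _ _ _]mxE (negPf kl) mulr0.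
rewrite addr0 !mxE !eqxx andbT andTb mulrC -mulrA -natrM mulnb.
by rewrite [(q == l) && _]andbC.
Qed.

Lemma adj_coef_sum a b j l : (j + l = m)%N ->
  adj_coef C m a b j l = (-1) ^+ (a + b) * (j.+1%:R - b%:R).
Proof.
by move=> e; rewrite /adj_coef e eqxx (_ : (m + 1 == m)%N = false); [rewrite /=; ring | lia].
Qed.

Lemma adj_coef_pred a b j l : (j + l + 1 = m)%N ->
  adj_coef C m a b j l = (-1) ^+ (a + b) * (l.+1%:R - a%:R).
Proof.
move=> e; rewrite /adj_coef e eqxx (_ : (j + l == m)%N = false); last lia.
by rewrite (_ : (m - j)%N = l.+1); [rewrite /=; ring | lia].
Qed.

(** This is the closed walk from level j through level m - j; the two signs cancel. *)
Lemma attains_B j (k : 'I_m.+1) : (j + k = m)%N ->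
  attains j j (fun a b => (j.+1%:R - b%:R) * (k.+1%:R - b%:R)).
Proof.
move=> jk; apply: attains_ext (attains_mul (attains_adj j k) (attains_adj k j)) _.
move=> a b; rewrite (adj_coef_sum _ _ jk) adj_coef_sum; last by rewrite addnC.
by rewrite mulrACA -exprD addnn -mul2n exprM sqrrN !expr1n mul1r.
Qed.

(** The hypotheses force j = i + 1: two steps of A_1 link consecutive levels through level m - j. *)
Lemma attains_step i j (k : 'I_m.+1) : (i + k + 1 = m)%N -> (k + j = m)%N ->
  attains i j (fun a b => (k.+1%:R - a%:R) * (k.+1%:R - b%:R)).
Proof.
move=> ik kj; apply: attains_ext (attains_mul (attains_adj i k) (attains_adj k j)) _.
move=> a b; rewrite (adj_coef_pred _ _ ik) (adj_coef_sum _ _ kj).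
by rewrite mulrACA -exprD addnn -mul2n exprM sqrrN !expr1n mul1r.
Qed.

Lemma attains_step' i j (k : 'I_m.+1) : (i + k = m)%N -> (k + j + 1 = m)%N ->
  attains i j (fun a b => (i.+1%:R - b%:R) * (j.+1%:R - a%:R)).
Proof.
move=> ik kj; apply: attains_ext (attains_mul (attains_adj i k) (attains_adj k j)) _.
move=> a b; rewrite (adj_coef_sum _ _ ik) (adj_coef_pred _ _ kj).
by rewrite mulrACA -exprD addnn -mul2n exprM sqrrN !expr1n mul1r.
Qed.

(** This is the other closed walk at level j, through level m - j - 1. *)
Lemma attains_A j (k : 'I_m.+1) : (j + k + 1 = m)%N ->
  attains j j (fun a b => (j.+1%:R - a%:R) * (k.+1%:R - a%:R)).
Proof.
move=> jk; apply: attains_ext (attains_mul (attains_adj j k) (attains_adj k j)) _.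
move=> a b; rewrite (adj_coef_pred _ _ jk) adj_coef_pred; last by rewrite [(k + j)%N]addnC.
rewrite mulrACA -exprD addnn -mul2n exprM sqrrN !expr1n mul1r.
by rewrite mulrC.
Qed.

Lemma blow_lt (b : block m) : (blow b < m)%N.
Proof. by rewrite /blow; lia. Qed.

Definition lowlev (b : block m) : 'I_m.+1 := Ordinal (ltnW (blow_lt b) : (blow b < m.+1)%N).

Lemma natr_sub_neq0 (x y : nat) : x != y -> x%:R - y%:R != 0 :> C.
Proof. by rewrite subr_eq0 eqr_nat. Qed.

(* The value at (a, b) minus the value at (a', b') of the chosen closed walk factors as
   (a' - a)(m + 1 - a - a'), resp. (b' - b)(m + 2 - b - b'). *)
Lemma separate (b b' : block m) : b' != b -> exists f,
  [/\ attains (lowlev b) (lowlev b) f, f (bA b) (bB b) != 0 & f (bA b') (bB b') = 0].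
Proof.
move=> bb'; pose j := lowlev b.
have jm : (j <= m)%N := ltnW (blow_lt b).
have [h1 h2 h3 h4] := block_bounds b; have [h1' h2' h3' h4'] := block_bounds b'.
have [eB|nB] := eqVneq (bB b') (bB b).
  have nA : bA b' != bA b by apply: contraNneq bb' => eA; rewrite (block_eq eA eB).
  have kP : (m - j - 1 < m.+1)%N by lia.
  pose k : 'I_m.+1 := Ordinal kP.
  have jk : (j + k + 1 = m)%N by have := blow_lt b; rewrite /=; lia.
  pose z : C := (j.+1%:R - (bA b')%:R) * (k.+1%:R - (bA b')%:R).
  have := attains_lin (- z) (attains_level j) (attains_A jk).
  move=> H; eexists; split; first exact: H; last by rewrite /z; ring.
  have -> : - z * 1 + (j.+1%:R - (bA b)%:R) * (k.+1%:R - (bA b)%:R) =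
     ((bA b')%:R - (bA b)%:R) * (m.+1%:R - (bA b + bA b')%:R).
    by rewrite /z -[in m.+1%:R]jk !natrD; ring.
  by rewrite mulf_neq0 // natr_sub_neq0 //; lia.
have kP : (m - j < m.+1)%N by lia.
pose k : 'I_m.+1 := Ordinal kP.
have jk : (j + k = m)%N by rewrite /=; lia.
pose z : C := (j.+1%:R - (bB b')%:R) * (k.+1%:R - (bB b')%:R).
have H := attains_lin (- z) (attains_level j) (attains_B jk).
eexists; split; first exact: H; last by rewrite /z; ring.
have -> : - z * 1 + (j.+1%:R - (bB b)%:R) * (k.+1%:R - (bB b)%:R) =
   ((bB b')%:R - (bB b)%:R) * (m.+2%:R - (bB b + bB b')%:R).
  by rewrite /z -[in m.+2%:R]jk !natrD; ring.
by rewrite mulf_neq0 // natr_sub_neq0 //; lia.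
Qed.

(** The separating functions of the other blocks are multiplied together, as in Lagrange
    interpolation. *)
Lemma corner (b : block m) : exists f, [/\ attains (lowlev b) (lowlev b) f,
  f (bA b) (bB b) != 0 & forall b', b' != b -> f (bA b') (bB b') = 0].
Proof.
suff H (s : seq (block m)) : exists f, [/\ attains (lowlev b) (lowlev b) f,
    f (bA b) (bB b) != 0 & forall b', b' \in s -> b' != b -> f (bA b') (bB b') = 0].
  have [f [h1 h2 h3]] := H (enum [set: block m]).
  by exists f; split=> // b'; apply: h3; rewrite mem_enum inE.
elim: s => [|b1 s [f [h1 h2 h3]]].
  by exists (fun _ _ => 1); split; [exact: attains_level | exact: oner_neq0 |].
have [->|/separate [g [g1 g2 g3]]] := eqVneq b1 b.
  by exists f; split=> // b'; rewrite inE => /predU1P[->|]; [rewrite eqxx | exact: h3].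
exists (fun x y => f x y * g x y); split; [exact: (attains_mul h1 g1) | by rewrite /= mulf_neq0 |].
move=> b'; rewrite inE => /predU1P[->|bs] ne; first by rewrite g3 mulr0.
by rewrite h3 // mul0r.
Qed.

(** The coefficients are nonzero by [block_bounds]: those of [up] because a <= [blow b] and b <=
    [blow b] + 1, those of [down] because both counts are at most m - ([blow b] + [bdeg b]). *)
Lemma ladder (b : block m) (p : 'I_(bdim b)) :
  (exists2 f, attains (blevel p) (lowlev b) f & f (bA b) (bB b) != 0) /\
  (exists2 f, attains (lowlev b) (blevel p) f & f (bA b) (bB b) != 0).
Proof.
have [h1 h2 h3 h4] := block_bounds b.
case: p => p; elim: p => [|p IH] pd.
  have -> : blevel (Ordinal pd) = lowlev b by apply: val_inj; rewrite /= addn0.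
  by split; exists (fun _ _ => 1); rewrite ?oner_neq0 //; exact: attains_level.
have pd' : (p < bdim b)%N := ltnW pd.
have [[f f1 f2] [g g1 g2]] := IH pd'.
have pd2 : (p.+1 < (bdeg b).+1)%N := pd.
have kP : (m - (blow b + p).+1 < m.+1)%N by lia.
pose k : 'I_m.+1 := Ordinal kP.
pose i := blevel (Ordinal pd'); pose j := blevel (Ordinal pd).
have iE : i = (blow b + p)%N :> nat by [].
have jE : j = (blow b + p).+1 :> nat by rewrite /= addnS.
have kE : k = (m - (blow b + p).+1)%N :> nat by [].
have up : attains j i (fun a b => (j.+1%:R - b%:R) * (i.+1%:R - a%:R)).
  by apply: (@attains_step' _ _ k); rewrite ?jE ?iE ?kE; lia.
have down : attains i j (fun a b => (k.+1%:R - a%:R) * (k.+1%:R - b%:R)).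
  by apply: attains_step; rewrite ?jE ?iE ?kE; lia.
split.
  eexists; first exact: (attains_mul up f1).
  by rewrite !mulf_neq0 // natr_sub_neq0 // ?iE ?jE; lia.
eexists; first exact: (attains_mul g1 down).
by rewrite !mulf_neq0 // natr_sub_neq0 // ?kE; lia.
Qed.

(** The matrix unit is factored through the lowest level of the block, where [corner] removes all
    other blocks; the remaining scalar is inverted. *)
Lemma block_unit (b : block m) (p q : 'I_(bdim b)) : exists M : 'M[C]_(nX m), exists c,
  [/\ acts M c, submx_block b c = delta_mx p q &
      forall b', b' != b -> submx_block b' c = 0].
Proof.
have [f [f1 f2 f3]] := corner b.
have [[g g1 g2] _] := ladder p; have [_ [g' g1' g2']] := ladder q.
have [M aM] := attains_mul g1 (attains_mul f1 g1').
pose F x y := g x y * (f x y * g' x y).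
have F0 : F (bA b) (bB b) != 0 by rewrite /F !mulf_neq0.
pose x := (F (bA b) (bB b))^-1.
exists (x *: M), (fun a b => (x * F a b) *: delta_mx (blevel p) (blevel q)); split.
- have [TM cM] := aM; split; first exact: TalgZ.
  by move=> a b' P PP; rewrite -scalemxAl (cM _ _ _ PP) scalemxAr scalerA.
- rewrite /submx_block mulVf // scale1r; apply/matrixP => r s; rewrite !mxE.
  by rewrite !(inj_eq (@blevel_inj _ b)).
move=> b' bb'; rewrite /submx_block.
have -> : F (bA b') (bB b') = 0 by rewrite /F f3 // mul0r mulr0.
by rewrite mulr0 scale0r; apply/matrixP => r s; rewrite !mxE.
Qed.

End Surjectivity.

(** * Assembling the isomorphism *)

Lemma lin_sum (C : nzRingType) (U V : lmodType C) (f : U -> V) (I : finType) (F : I -> U) :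
  (forall x u v, f (x *: u + v) = x *: f u + f v) -> f (\sum_i F i) = \sum_i f (F i).
Proof.
move=> lf; apply: (big_morph f) => [u v|]; first by have := lf 1 u v; rewrite !scale1r.
(* The scalar -1 at zero vectors gives f 0 = - f 0 + f 0 = 0. *)
by have := lf (-1) 0 0; rewrite scaler0 addr0 scaleN1r addNr.
Qed.

Lemma Talg_sum (C : comNzRingType) m (I : finType) (F : I -> 'M[C]_(nX m)) :
  (forall i, Talg (F i)) -> Talg (\sum_i F i).
Proof. by move=> TF; apply: big_ind => //; [exact: Talg0 | exact: TalgD]. Qed.

Theorem Talg_iso (C : numFieldType) (m : nat) : (0 < m)%N ->
  exists phi : forall b : block m, 'M[C]_(nX m) -> 'M[C]_(bdim b),
    alg_iso_onto_sum (@Talg C m) phi.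
Proof.
move=> m0; have [phi Hphi] := fin_all_exists (@block_rep C m).
have lin b x M N : phi b (x *: M + N) = x *: phi b M + phi b N by case: (Hphi b).
have phiE b M c : acts M c -> phi b M = submx_block b c by case: (Hphi b) => _ + _; apply.
exists phi; split.
- by move=> b x M N _ _; exact: lin.
- move=> b M N /Talg_acts[c cM] /Talg_acts[c' cN].
  rewrite (phiE _ _ _ (acts_mul cM cN)) (phiE _ _ _ cM) (phiE _ _ _ cN).
  (* The sum over all levels reduces to those of the block, as the other entries of c in these rows
     are zero. *)
  apply/matrixP => p q; rewrite !mxE (sum_codom (@blevel_inj _ b)).
    by apply: eq_bigr => r _; rewrite !mxE.
  by move=> j jb; have [_ _ /(_ _ _ cM) ->] := Hphi b; rewrite ?mul0r.
- move=> b; have c1 : acts (1%:M : 'M[C]_(nX m)) (fun _ _ => 1%:M).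
    by split=> [|a b' P _]; [exact: Talg1 | rewrite mul1mx mulmx1].
  rewrite (phiE _ _ _ c1); apply/matrixP => p q.
  by rewrite !mxE (inj_eq (@blevel_inj _ b)).
- move=> M TM M0; apply: faithful TM _ => b c cM.
  by rewrite -(phiE _ _ _ cM).
move=> N.
(* Each component of N is lifted separately with zero image in the other blocks; the preimage of N
   is the sum of the lifts. *)
have unit b : exists M, [/\ Talg M, phi b M = N b & forall b', b' != b -> phi b' M = 0].
  have H (pq : 'I_(bdim b) * 'I_(bdim b)) : exists M, [/\ Talg M, phi b M = delta_mx pq.1 pq.2
      & forall b', b' != b -> phi b' M = 0].
    have [M [c [cM c1 c2]]] := block_unit C m0 pq.1 pq.2.
    by exists M; split; [exact: cM.1 | rewrite (phiE _ _ _ cM) |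
      move=> b' /c2; rewrite (phiE _ _ _ cM)].
  have [E HE] := fin_all_exists H.
  have phiZ b' x M : phi b' (x *: M) = x *: phi b' M.
    have := lin b' x M 0; rewrite addr0 => ->.
    by have := lin b' (-1) 0 0; rewrite scaler0 addr0 scaleN1r addNr => ->; rewrite addr0.
  exists (\sum_pq N b pq.1 pq.2 *: E pq); split.
  - by apply: Talg_sum => pq; apply: TalgZ; case: (HE pq).
  - rewrite (lin_sum _ (lin b)); under eq_bigr => pq _ do rewrite phiZ.
    rewrite [RHS]matrix_sum_delta pair_big /=; apply: eq_bigr => pq _.
    by case: (HE pq) => _ -> _.
  - move=> b' bb'; rewrite (lin_sum _ (lin b')) big1 // => pq _.
    by rewrite phiZ; case: (HE pq) => _ _ -> //; rewrite scaler0.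
have [E HE] := fin_all_exists unit.
exists (\sum_b E b); first by apply: Talg_sum => b; case: (HE b).
move=> b; rewrite (lin_sum _ (lin b)) (bigD1 b) //= big1 ?addr0; first by case: (HE b).
by move=> b' bb'; case: (HE b') => _ _ -> //; rewrite eq_sym.
Qed.

Theorem theorem4p3 (R : realType) (m : nat) (hm : (3 <= m)%N) :
  exists phi : forall b : block m, 'M[R[i]]_(nX m) -> 'M[R[i]]_(bdim b),
    @alg_iso_onto_sum R[i] (nX m) (block m) (@bdim m) (@Talg R[i] m) phi.
Proof. exact: (@Talg_iso R[i] m (ltnW (ltnW hm))). Qed.
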